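(* Let $C$ be a finite set of constants, let $M$ be a semilattice model over $C$ atomized by a set of atoms (which may or may not contain atoms redundant with $M$), and let $r=(r_L,r_R)$ be a duple over $C$ such that $M\models r^-$. Then the full crossing of $r$ in $M$ is the freest model of $Th_0^+(M)\cup\{r^+\}$: $$\square_r M = F_C\big(Th_0^+(M)\cup\{r^+\}\big).$$
   Context: A semilattice is a nonempty set with a commutative, associative, idempotent binary operation $\odot$, ordered by $a\le b$ iff $a\odot b=b$. For a finite set $C$ of constants, $F_C(\emptyset)$ is the free semilattice on $C$; its elements (terms) $t$ are identified with their nonempty sets $\mathbf{C}(t)\subseteq C$ of component constants, with $\odot$ acting as union. A semilattice model over $C$ is a semilattice $M$ with a map $C\to M$ whose image generates $M$; it induces the natural homomorphism $\nu_M:F_C(\emptyset)\to M$. A duple over $C$ is an ordered pair $r=(r_L,r_R)$ of terms; $M\models r^+$ means $\nu_M(r_L)\le\nu_M(r_R)$, and $M\models r^-$ means $\nu_M(r_L)\not\le\nu_M(r_R)$. $Th_0^+(M)$ is the set of all positive duples $r^+$ with $M\models r^+$. Two models over $C$ are regarded as equal if they satisfy the same positive duples. An atom $\phi$ over $C$ is determined by a nonempty subset $\mathbf{U}^c(\phi)\subseteq C$; for a term $t$, $\phi<t$ means $\mathbf{C}(t)\cap\mathbf{U}^c(\phi)\ne\emptyset$. A set $A$ of atoms over $C$ atomizes $M$ if every $c\in C$ satisfies $\phi<c$ for some $\phi\in A$, and for all terms $t,s$: $\nu_M(t)\le\nu_M(s)$ iff there is no $\phi\in A$ with $\phi<t$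 and $\phi\not<s$. An atom $\phi$ is in $M$ if it belongs to some set of atoms that atomizes $M$; it is redundant with $M$ if for each constant $c$ with $\phi<c$ there is an atom $\eta$ in $M$ with $\eta<c$ and $\mathbf{U}^c(\eta)\subsetneq\mathbf{U}^c(\phi)$. The union $\phi\bigtriangledown\psi$ of two atoms is the atom with $\mathbf{U}^c(\phi\bigtriangledown\psi)=\mathbf{U}^c(\phi)\cup\mathbf{U}^c(\psi)$. Full crossing: if $M$ is atomized by $A$, put $H=\{\phi\in A:\phi<r_L,\ \phi\not<r_R\}$ and $B=\{\phi\in A:\phi<r_R\}$; then $\square_r M$ is the model over $C$ atomized by $(A\setminus H)\cup\{\lambda\bigtriangledown\rho:\lambda\in H,\ \rho\in B\}$. For a set $R^+$ of positive duples, $F_C(R^+)$ denotes the freest model over $C$ satisfying $R^+$: the model over $C$ that satisfies every duple in $R^+$ and such that every positive duple it satisfies is satisfied by every model over $C$ of $R^+$. *)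

(* Defs.v *)
From HB Require Import structures.
From mathcomp Require Import all_boot all_order.

Set Implicit Arguments.
Unset Strict Implicit.
Unset Printing Implicit Defensive.

Import Order.TTheory.
Local Open Scope order_scope.

(* A term t is represented by its nonempty set C(t) of component constants. *)
Record term (C : finType) := Term { comps :> {set C}; _ : comps != set0 }.
HB.instance Definition _ C := [isSub for @comps C].
HB.instance Definition _ C := [Finite of term C by <:].

(* An atom phi is represented by its nonempty set U^c(phi). *)
Record atom (C : finType) := Atom { upc :> {set C}; _ : upc != set0 }.
HB.instance Definition _ C := [isSub for @upc C].
HB.instance Definition _ C := [Finite of atom C by <:].

Section Terms.
Variable C : finType.
Implicit Types (c : C) (t s : term C).

Lemma const_term_proof c : [set c] != set0.
Proof. by apply/set0Pn; exists c; rewrite set11. Qed.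

Definition const_term c : term C := Term (const_term_proof c).

Lemma joint_proof t s : comps t :|: comps s != set0.
Proof. by case: t => t /= t0; rewrite setU_eq0 (negbTE t0). Qed.

(* The operation of the free semilattice F_C(emptyset). *)
Definition joint t s : term C := Term (joint_proof t s).

Lemma term_nonempty t : exists c, c \in comps t.
Proof. by apply/set0Pn; case: t. Qed.

End Terms.

(* The semilattice axioms are those of [joinSemilatticeType], with
   a <= b iff a `|` b = b ([leEjoin]).  When C is nonempty the carrier is
   nonempty; when C is empty, [generated] makes the carrier empty. *)
Record model (C : finType) := Model {
  model_disp : Order.disp_t;
  carrier :> joinSemilatticeType model_disp;
  const : C -> carrier;
  generated : forall P : carrier -> Prop,
    (forall c, P (const c)) -> (forall a b, P a -> P b -> P (a `|` b)) ->
    forall a, P a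
}.

Section Models.
Variable C : finType.
Implicit Types (M : model C) (t s : term C).

(* The natural homomorphism F_C(emptyset) -> M.  As M need not have a bottom
   element, the join of the constants of t starts from one of them, which is
   harmless by idempotence; [nu_const] and [nu_joint] characterize it. *)
Definition nu M t : M :=
  \big[Order.join/const M (xchoose (term_nonempty t))]_(c in comps t) const M c.

Lemma nu_le M t (x : M) : (nu M t <= x) = [forall c in comps t, const M c <= x].
Proof.
apply/idP/forall_inP => [le_tx c ct | le_cx].
  apply: le_trans le_tx; rewrite /nu -big_filter.
  have : c \in [seq d <- index_enum C | d \in comps t].
    by rewrite mem_filter ct mem_index_enum.
  elim: [seq _ <- _ | _] => //= d e IHe; rewrite inE big_cons.
  by case/orP=> [/eqP <- | /IHe le_c]; [exact: leUl | exact: lexUr].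
apply: (big_ind (fun y => y <= x)) => //; first exact/le_cx/xchooseP.
by move=> y z yx zx; rewrite leUx yx.
Qed.

Lemma nu_const M c : nu M (const_term c) = const M c.
Proof.
apply/le_anti/andP; split.
  by rewrite nu_le; apply/forall_inP => d /set1P ->.
have := lexx (nu M (const_term c)); rewrite {1}nu_le => /forall_inP; apply.
exact: set11.
Qed.

Lemma nu_joint M t s : nu M (joint t s) = nu M t `|` nu M s.
Proof.
have le_const u c : c \in comps u -> const M c <= nu M u.
  by move: c; apply/forall_inP; rewrite -nu_le.
apply/le_anti/andP; split.
  rewrite nu_le; apply/forall_inP => c /setUP[] /le_const.
    exact: lexUl.
  exact: lexUr.
rewrite leUx !nu_le; apply/andP; split; apply/forall_inP => c cu.
  by apply: le_const; rewrite inE cu.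
by apply: le_const; rewrite inE cu orbT.
Qed.

End Models.

Section Duples.
Variable C : finType.
Implicit Types (M N : model C).

(* A duple r has left term r.1 and right term r.2. *)
Definition duple := (term C * term C)%type.
Implicit Type r : duple.

Definition sat_pos M r : bool := nu M r.1 <= nu M r.2.
Definition sat_neg M r : bool := ~~ (nu M r.1 <= nu M r.2).

Definition Th0_pos M : {set duple} := [set r | sat_pos M r].

Definition satisfies M (R : {set duple}) : Prop :=
  forall r, r \in R -> sat_pos M r.

(* N is F_C(R^+); this determines N up to equality of [Th0_pos]. *)
Definition is_freest (R : {set duple}) N : Prop :=
  satisfies N R /\
  forall r, sat_pos N r -> forall M, satisfies M R -> sat_pos M r.

End Duples.

Section Atoms.
Variable C : finType.
Implicit Types (phi psi : atom C) (t s : term C) (A : {set atom C}).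

(* phi < t *)
Definition atom_lt phi t : bool := comps t :&: upc phi != set0.

(* This determines M up to equality of [Th0_pos]. *)
Definition atomizes A (M : model C) : Prop :=
  (forall c, exists2 phi, phi \in A & atom_lt phi (const_term c)) /\
  forall t s, nu M t <= nu M s <->
    ~ exists phi, [/\ phi \in A, atom_lt phi t & ~~ atom_lt phi s].

Lemma atom_union_proof phi psi : upc phi :|: upc psi != set0.
Proof. by case: phi => u /= u0; rewrite setU_eq0 (negbTE u0). Qed.

Definition atom_union phi psi : atom C := Atom (atom_union_proof phi psi).

Definition full_crossing_atoms A (r : duple C) : {set atom C} :=
  let H := [set phi in A | atom_lt phi r.1 && ~~ atom_lt phi r.2] in
  let B := [set phi in A | atom_lt phi r.2] in
  (A :\: H) :|: [set atom_union lambda rho | lambda in H, rho in B].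

(* N is the full crossing of r in the model atomized by A. *)
Definition is_full_crossing A (r : duple C) (N : model C) : Prop :=
  atomizes (full_crossing_atoms A r) N.

End Atoms.

(* Main.v *)
Require Import Defs.
From HB Require Import structures.
From mathcomp Require Import all_boot all_order.

Set Implicit Arguments.
Unset Strict Implicit.
Unset Printing Implicit Defensive.

Import Order.TTheory.
Local Open Scope order_scope.

(** Suppose that t <= s holds in the crossing but not in M.  Some lambda in H
then lies below t and not below s; the atoms lambda \/ rho with rho in B lie
below t, hence below s, so every rho in B lies below s and r_R <= s in M.  As
the atoms outside H survive and those of H lie below r_L, also t <= s (.) r_L
in M.  A model of Th_0^+(M) and r^+ thus satisfies
t <= s (.) r_L <= s (.) r_R <= s. *)

(** By induction on the number of component constants: split off one constant, and either nothing is
    left or the rest is a smaller term. *)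
Lemma term_ind (C : finType) (P : term C -> Prop) :
  (forall c, P (const_term c)) -> (forall t s, P t -> P s -> P (joint t s)) ->
  forall t, P t.
Proof.
move=> Pc Pj t; have [n] := ubnP #|comps t|; elim: n t => // n IHn t lt_tn.
have [c ct] := term_nonempty t; have [t0 | t0] := eqVneq (comps t :\ c) set0.
  suff -> : t = const_term c by [].
  by apply: val_inj; rewrite /= -(setD1K ct) t0 setU0.
have -> : t = joint (const_term c) (Term t0).
  by apply: val_inj; rewrite /= setD1K.
by apply: Pj => //; apply: IHn; move: lt_tn; rewrite (cardsD1 c) ct.
Qed.

(** * The order between atoms and terms *)

Section AtomLt.
Variable C : finType.
Implicit Types (phi psi : atom C) (t s : term C).

Lemma atom_ltP phi t :
  reflect (exists2 c, c \in comps t & c \in upc phi) (atom_lt phi t).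
Proof.
rewrite /atom_lt; apply: (iffP (set0Pn _)) => [[c /setIP[ct cphi]] | [c ct cphi]];
  by exists c => //; apply/setIP.
Qed.

Lemma atom_lt_const phi c : atom_lt phi (const_term c) = (c \in upc phi).
Proof.
by apply/atom_ltP/idP => [[d /set1P ->] | cphi] //; exists c; rewrite ?set11.
Qed.

Lemma atom_lt_union phi psi t :
  atom_lt (atom_union phi psi) t = atom_lt phi t || atom_lt psi t.
Proof. by rewrite /atom_lt /= setIUr setU_eq0 negb_and. Qed.

Lemma atom_lt_joint phi t s :
  atom_lt phi (joint t s) = atom_lt phi t || atom_lt phi s.
Proof. by rewrite /atom_lt /= setIUl setU_eq0 negb_and. Qed.

End AtomLt.

(** * Atomization as inclusion between the atoms below two terms *)

Section Covering.
Variables (C : finType) (A : {set atom C}).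

Definition covers := forall c : C, exists2 phi, phi \in A & c \in upc phi.

Lemma covers_term (t : term C) :
  covers -> exists2 phi, phi \in A & atom_lt phi t.
Proof.
move=> covA; have [c ct] := term_nonempty t; have [phi phiA cphi] := covA c.
by exists phi => //; apply/atom_ltP; exists c.
Qed.

(** Since [atom_lt] is boolean, the absence of an atom separating the two terms can be read as an
    implication, which the later arguments apply directly to a given atom. *)
Lemma atomizesP (M : model C) :
  atomizes A M <->
  covers /\ forall r,
    sat_pos M r <-> {in A, forall phi, atom_lt phi r.1 -> atom_lt phi r.2}.
Proof.
split=> [[covA leA] | [covA leA]]; split.
- by move=> c; have [phi phiA] := covA c; rewrite atom_lt_const; exists phi.
- move=> [t s]; split=> [/leA noA phi phiA phit | le_ts].
    by apply: contraT => phis; case: noA; exists phi.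
  by apply/leA=> -[phi [phiA /(le_ts _ phiA) /= ->]].
- by move=> c; have [phi phiA cphi] := covA c; exists phi; rewrite ?atom_lt_const.
- move=> t s; split=> [/(leA (t, s)) le_ts [phi [phiA /(le_ts _ phiA) /= ->]] | noA] //.
  apply/(leA (t, s)) => phi phiA phit.
  by apply: contraT => phis; case: noA; exists phi.
Qed.

End Covering.

(* The model atomized by K: a term t is sent to the set of atoms of K below t. *)
Section AtomizedModel.
Variables (C : finType) (K : {set atom C}).
Implicit Types (c : C) (t s : term C).

Definition atoms_below t : {set atom C} := [set phi in K | atom_lt phi t].

Lemma atoms_below_joint t s :
  atoms_below (joint t s) = atoms_below t :|: atoms_below s.
Proof. by apply/setP=> phi; rewrite !inE atom_lt_joint andb_orr. Qed.

(** The carrier is cut down to these sets so that the constants generate it: an arbitrary subset of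
    [K] need not be a union of the sets attached to constants. *)
Definition is_atoms_below (X : {set atom C}) := [exists t, X == atoms_below t].

Record atom_model :=
  AtomModel { atom_model_val :> {set atom C}; _ : is_atoms_below atom_model_val }.
HB.instance Definition _ := [isSub for atom_model_val].
HB.instance Definition _ := [Choice of atom_model by <:].

Implicit Types x y z : atom_model.

Definition atom_model_le x y := x \subset (y : {set _}).

Lemma atom_model_le_refl : reflexive atom_model_le.
Proof. by move=> x; apply: subxx. Qed.

Lemma atom_model_le_anti : antisymmetric atom_model_le.
Proof. by move=> x y; rewrite -[_ && _]eqEsubset => /eqP/val_inj. Qed.

Lemma atom_model_le_trans : transitive atom_model_le.
Proof. by move=> y x z; apply: subset_trans. Qed.

HB.instance Definition _ := Order.Le_isPOrder.Build (Order.Disp tt tt) atom_model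
  atom_model_le_refl atom_model_le_anti atom_model_le_trans.

Lemma atom_model_join_proof x y : is_atoms_below (x :|: y).
Proof.
have [[t /eqP xt] [s /eqP ys]] := (existsP (valP x), existsP (valP y)).
by apply/existsP; exists (joint t s); rewrite atoms_below_joint -xt -ys.
Qed.

Definition atom_model_join x y := AtomModel (atom_model_join_proof x y).

Lemma atom_model_leUx x y z :
  (atom_model_join x y <= z) = (x <= z) && (y <= z).
Proof. exact: subUset. Qed.

HB.instance Definition _ := Order.POrder_isJoinSemilattice.Build
  (Order.Disp tt tt) atom_model atom_model_leUx.

Lemma atom_model_term_proof t : is_atoms_below (atoms_below t).
Proof. by apply/existsP; exists t. Qed.

Definition atom_model_term t : atom_model := AtomModel (atom_model_term_proof t).

Definition atom_model_const c := atom_model_term (const_term c).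

Lemma atom_model_term_joint t s :
  atom_model_term (joint t s) = atom_model_term t `|` atom_model_term s.
Proof. by apply: val_inj; apply: atoms_below_joint. Qed.

Lemma atom_model_generated (P : atom_model -> Prop) :
    (forall c, P (atom_model_const c)) ->
    (forall x y, P x -> P y -> P (x `|` y)) ->
  forall x, P x.
Proof.
move=> Pc Pj x; have [t xt] := existsP (valP x).
have -> : x = atom_model_term t by apply: val_inj; apply/eqP.
by elim/term_ind: t {x xt} => // t s Pt Ps; rewrite atom_model_term_joint; apply: Pj.
Qed.

Definition model_of_atoms : model C := Model atom_model_generated.

Lemma nu_model_of_atoms t : nu model_of_atoms t = atom_model_term t.
Proof.
elim/term_ind: t => [c | t s IHt IHs]; first exact: nu_const.
by rewrite nu_joint IHt IHs atom_model_term_joint.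
Qed.

Lemma model_of_atoms_atomizes : covers K -> atomizes K model_of_atoms.
Proof.
move=> covK; apply/atomizesP; split=> // r.
rewrite /sat_pos !nu_model_of_atoms.
split=> [/subsetP le_r phi phiK phir | le_r].
  by have := le_r phi; rewrite /= !inE phiK => /(_ phir).
by apply/subsetP => phi; rewrite !inE => /andP[phiK /(le_r _ phiK) ->]; rewrite phiK.
Qed.

End AtomizedModel.

(** * The atoms of the crossing and freeness of the model they atomize *)

Section FullCrossing.
Variables (C : finType) (A : {set atom C}) (r : duple C).
Local Notation K := (full_crossing_atoms A r).

Lemma full_crossing_keep phi : phi \in A ->
  (atom_lt phi r.1 -> atom_lt phi r.2) -> phi \in K.
Proof.
move=> phiA phir; apply/setUP; left; rewrite !inE phiA andbT /=.
by apply/negP=> /andP[/phir ->].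
Qed.

Lemma full_crossing_union phi psi : phi \in A -> psi \in A ->
  atom_lt phi r.1 -> ~~ atom_lt phi r.2 -> atom_lt psi r.2 ->
  atom_union phi psi \in K.
Proof.
move=> phiA psiA phi1 phi2 psi2; apply/setUP; right.
by apply/imset2P; exists phi psi; rewrite // !inE ?phiA ?psiA ?phi1.
Qed.

Lemma full_crossingP phi : phi \in K ->
  (phi \in A /\ (atom_lt phi r.1 -> atom_lt phi r.2)) \/
  exists lambda rho, [/\ lambda \in A, rho \in A, atom_lt rho r.2
                       & phi = atom_union lambda rho].
Proof.
case/setUP=> [/setDP[phiA] | /imset2P[la rho]].
  rewrite inE phiA /= negb_and negbK => phir; left; split=> // phi1.
  by rewrite phi1 in phir.
by rewrite !inE => /andP[laA _] /andP[rhoA rho2] ->; right; exists la, rho.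
Qed.

(** If the atom of [A] covering c lies in H, it is removed, but its union with any atom below [r.2]
    still contains c. Such an atom exists because [A] covers the constants of [r.2]. *)
Lemma full_crossing_covers : covers A -> covers K.
Proof.
move=> covA c; have [phi phiA cphi] := covA c.
have [/andP[phi1 phi2] | Hphi] := boolP (atom_lt phi r.1 && ~~ atom_lt phi r.2).
  have [rho rhoA rho2] := covers_term r.2 covA.
  by exists (atom_union phi rho); [apply: full_crossing_union | rewrite inE cphi].
exists phi => //; apply: full_crossing_keep => // phi1.
by move: Hphi; rewrite phi1 negbK.
Qed.

Lemma full_crossing_freest (M N : model C) :
  atomizes A M -> is_full_crossing A r N -> is_freest (r |: Th0_pos M) N.
Proof.
move=> /atomizesP[covA satM] /atomizesP[_ satN]; split=> [q | [t s]].
  rewrite !inE => q_or; apply/satN => phi /full_crossingP[].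
    by case=> phiA phir; case/orP: q_or => [/eqP -> // | /satM]; apply.
  (* A union lies below [r.2] through [rho], so it cannot violate r. A duple of M is respected by
     both parts, hence by their union. *)
  case=> la [rho [laA rhoA rho2 ->]]; rewrite !atom_lt_union.
  case/orP: q_or => [/eqP -> | /satM le_q]; first by rewrite rho2 orbT.
  by case/orP=> /le_q -> //; rewrite orbT.
move=> /satN /= le_ts M' satM'.
have satM'M q : sat_pos M q -> sat_pos M' q.
  by move=> qM; apply: satM'; rewrite !inE qM orbT.
(* Search for an atom of H separating t from s. If there is none, t <= s already holds in M: a
   separating atom outside H would survive in [K] and contradict [le_ts]. *)
have [la /and5P[laA la_t la_s la1 la2] | noH] := pickP (fun la =>
    [&& la \in A, atom_lt la t, ~~ atom_lt la s, atom_lt la r.1 & ~~ atom_lt la r.2]);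
    last first.
  apply/satM'M/satM => phi phiA /= phit; apply: contraFT (noH phi) => phis.
  rewrite phiA phit phis /=; have [// | Hphi] := boolP (_ && _).
  move: phis; rewrite le_ts //; apply: full_crossing_keep => // phi1.
  by move: Hphi; rewrite phi1 negbK.
have r2_s : sat_pos M (r.2, s).
  apply/satM => rho rhoA /= rho2.
  have := le_ts _ (full_crossing_union laA rhoA la1 la2 rho2).
  by rewrite !atom_lt_union la_t (negbTE la_s); apply.
have t_sr1 : sat_pos M (t, joint s r.1).
  apply/satM => phi phiA /= phit; rewrite atom_lt_joint.
  have [_ | /negP phi1] := boolP (atom_lt phi r.1); first by rewrite orbT.
  by rewrite orbF; apply: le_ts => //; apply: full_crossing_keep.
have r12 : sat_pos M' r by apply: satM'; rewrite setU11.
apply: le_trans (satM'M _ t_sr1) _ => /=.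
by rewrite nu_joint leUx lexx (le_trans r12 (satM'M _ r2_s)).
Qed.

End FullCrossing.

(** * Identification of models through their positive duples *)

Lemma is_freest_sat_pos (C : finType) (R : {set duple C}) (N N' : model C) :
  is_freest R N -> is_freest R N' -> sat_pos N =1 sat_pos N'.
Proof.
move=> [satN freeN] [satN' freeN'] q.
by apply/idP/idP => [/freeN | /freeN']; apply.
Qed.

Lemma eq_atomizes (C : finType) (A : {set atom C}) (N N' : model C) :
  sat_pos N =1 sat_pos N' -> atomizes A N -> atomizes A N'.
Proof.
move=> eqN /atomizesP[covA satN]; apply/atomizesP; split=> // q.
by rewrite -eqN.
Qed.

Theorem theorem16 (C : finType) (M : model C) (A : {set atom C})
    (hA : atomizes A M) (r : duple C) (hr : sat_neg M r) :
  (exists N : model C, is_full_crossing A r N) /\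
  (forall N : model C,
     is_full_crossing A r N <-> is_freest (r |: Th0_pos M) N).
Proof.
have [covA _] := (atomizesP A M).1 hA.
have crossN0 := model_of_atoms_atomizes (full_crossing_covers r covA).
split; first by exists (model_of_atoms (full_crossing_atoms A r)).
move=> N; split=> [|freeN]; first exact: full_crossing_freest.
(* Any freest model has the same positive duples as the concrete crossing model, which is freest
   too, and atomization depends only on those duples. *)
apply: (eq_atomizes _ crossN0).
exact: is_freest_sat_pos (full_crossing_freest hA crossN0) freeN.
Qed.
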